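(* Let $n>k\geq m\geq 1$. Suppose $A$ is a $k$-subspace and $B$ is an $m$-subspace of $\mathbb{Z}_{p^s}^n$ with $B\nsubseteq A$. Then there is $U\in GL_n(\mathbb{Z}_{p^s})$ such that $$A=(0, I_k)U \quad\text{and}\quad B=(D, I_m)U,$$ where $D=\mathrm{diag}(p^{i_1}, \ldots, p^{i_r}, 0_{m-r, n-m-r})$ is an $m\times(n-m)$ matrix, $1\leq r\leq \min\{m, n-k\}$ and $0\leq i_1\leq \cdots \leq i_r\leq \max\{s-1, 1\}$.
   Context: $p$ is a prime, $s\ge1$, $R=\mathbb{Z}_{p^s}$; vectors are row vectors. A set $\{\alpha_1,\dots,\alpha_k\}\subseteq R^n$ is unimodular if the matrix with rows $\alpha_i$ has a right inverse over $R$. A $k$-subspace of $R^n$ is a submodule having a unimodular basis of $k$ vectors. A subspace is identified with a matrix representation (a matrix whose rows form such a basis); an equality like $A=(0,I_k)U$ means $A$ is the row space of the matrix $(0,I_k)U$. $\mathrm{diag}(\cdots)$ denotes a block-diagonal matrix, $0_{a,b}$ the $a\times b$ zero matrix. *)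

(* Defs.v *)
From HB Require Import structures.
From mathcomp Require Export all_boot all_order all_algebra.

Set Implicit Arguments.
Unset Strict Implicit.
Unset Printing Implicit Defensive.

Import GRing.Theory.
Local Open Scope ring_scope.

Section Subspaces.

Variables (R : finComNzRingType) (n : nat).

Definition row_space (k : nat) (M : 'M[R]_(k, n)) : {set 'rV[R]_n} :=
  [set x *m M | x : 'rV[R]_k].

Definition unimodular (k : nat) (M : 'M[R]_(k, n)) : Prop :=
  exists N : 'M[R]_(n, k), M *m N = 1%:M.

Definition row_basis (k : nat) (M : 'M[R]_(k, n)) (A : {set 'rV[R]_n}) : Prop :=
  (forall x : 'rV[R]_k, x *m M = 0 -> x = 0) /\ A = row_space M.

Definition is_subspace (k : nat) (A : {set 'rV[R]_n}) : Prop :=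
  submod_closed A /\
  exists M : 'M[R]_(k, n), unimodular M /\ row_basis M A.

(* The k x n matrix (D, I_k); the cast only identifies (n - k) + k with n. *)
Definition row_mxI (k : nat) (le_kn : (k <= n)%N) (D : 'M[R]_(k, n - k)) :
    'M[R]_(k, n) :=
  castmx (erefl k, subnK le_kn) (row_mx D 1%:M).

End Subspaces.

(* diag(p^(i_1), ..., p^(i_r), 0_(a-r, b-r)); meaningful for r <= a and r <= b *)
Definition diag_ppow (R : comNzRingType) (p a b r : nat) (i : r.-tuple nat) :
    'M[R]_(a, b) :=
  \matrix_(x < a, y < b)
    if (x == y :> nat) && (x < r)%N then p%:R ^+ nth 0%N i x else 0.

(* Main.v *)
Require Import Defs.
From mathcomp Require Import all_boot all_order all_algebra perm zify.

Set Implicit Arguments.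
Unset Strict Implicit.
Unset Printing Implicit Defensive.

Import GRing.Theory.
Local Open Scope ring_scope.

(** By the Smith normal form over the integers, every matrix over [Z/p^s] is
    equivalent to a diagonal matrix of powers of [p]; a unimodular matrix is
    therefore equivalent to [(0, I_k)].  Choose coordinates in which
    [A = (0, I_k)] and [B = (X, Y)], with [X] in Smith form [S].  Adding to [Y]
    combinations of the columns of [X] preserves [A], and since [Z/p^s] has
    stable range one (here [m <= k] is used) it can make [Y] unimodular; a
    change of basis of [A] then turns [Y] into [(0, I_m)]. *)

(** * Unimodular matrices over a finite commutative ring *)

Section Unimodular.

Variable R : finComUnitRingType.

Lemma row_space_mull k n (P : 'M[R]_k) (M : 'M[R]_(k, n)) :
  P \in unitmx -> row_space (P *m M) = row_space M.
Proof.
move=> Pu; apply/setP=> v; apply/imsetP/imsetP => -[x _ ->].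
  by exists (x *m P) => //; rewrite mulmxA.
by exists (x *m invmx P) => //; rewrite mulmxA mulmxKV.
Qed.

Lemma unimodular_mul k n (P : 'M[R]_k) (M : 'M[R]_(k, n)) (Q : 'M[R]_n) :
  P \in unitmx -> Q \in unitmx -> unimodular M -> unimodular (P *m M *m Q).
Proof.
move=> Pu Qu [N MN1]; exists (invmx Q *m N *m invmx P).
by rewrite !mulmxA mulmxK // -(mulmxA P) MN1 mulmx1 mulmxV.
Qed.

Lemma unitmx_1B_nilpotent k (C : 'M[R]_k) (e : nat) :
  C ^+ e = 0 -> 1%:M - C \in unitmx.
Proof.
move=> Ce0; have := subrX1 C e; rewrite Ce0 sub0r => /(congr1 -%R).
rewrite opprK -mulNr opprB => /esym/mulmx1_unit.
by case.
Qed.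

(** A right inverse [N] of [M] gives [(M + a *: C) *m N = 1 + a *: (C *m N)], which is invertible
    because [a] is nilpotent. *)
Lemma unimodular_add_nilpotent k n (a : R) (M C : 'M[R]_(k, n)) (e : nat) :
  a ^+ e = 0 -> unimodular M -> unimodular (M + a *: C).
Proof.
move=> ae0 [N MN1].
have Gu : (M + a *: C) *m N \in unitmx.
  rewrite mulmxDl MN1 -scalemxAl -[X in _ + X]opprK -scaleNr.
  apply: (@unitmx_1B_nilpotent _ _ e).
  rewrite -mul_scalar_mx -[_ *m _]/(_ * _) exprMn_comm;
    last by apply: comm_scalar_mx.
  by rewrite -[X in X * _]rmorphXn exprNn ae0 mulr0 raddf0 mul0r.
by exists (N *m invmx ((M + a *: C) *m N)); rewrite mulmxA mulmxV.
Qed.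

Lemma castmx_mul_sqr k n n' (e : n = n') (A : 'M[R]_(k, n)) (U : 'M[R]_n) :
  castmx (erefl k, e) A *m castmx (e, e) U = castmx (erefl k, e) (A *m U).
Proof. by case: n' / e; rewrite !castmx_id. Qed.

Lemma castmx_mulr a k n n' (e : n = n') (A : 'M[R]_(a, k)) (B : 'M[R]_(k, n)) :
  castmx (erefl a, e) (A *m B) = A *m castmx (erefl k, e) B.
Proof. by case: n' / e; rewrite !castmx_id. Qed.

Lemma castmx_unit n n' (e : n = n') (U : 'M[R]_n) :
  (castmx (e, e) U \in unitmx) = (U \in unitmx).
Proof. by case: n' / e; rewrite castmx_id. Qed.

Lemma castmx_unimodular k n n' (e : n = n') (M : 'M[R]_(k, n)) :
  unimodular M -> unimodular (castmx (erefl k, e) M).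
Proof. by case: n' / e; rewrite castmx_id. Qed.

(** [f] takes natural numbers so that it can be evaluated at a column index of the wider matrix. *)
Lemma row_mxIE n k (le_kn : (k <= n)%N) (f : nat -> nat -> R) :
  row_mxI le_kn (\matrix_(x, y) f x y) =
  \matrix_(x, y) if (y < n - k)%N then f x y else (y == n - k + x :> nat)%N%:R.
Proof.
apply/matrixP=> x y; rewrite castmxE !mxE cast_ord_id.
case: splitP => z /= zE; rewrite mxE zE; first by rewrite ltn_ord.
by rewrite ltnNge leq_addr /= eqn_add2l eq_sym.
Qed.

Lemma row_mxI0E n k (le_kn : (k <= n)%N) :
  row_mxI le_kn (0 : 'M[R]__) = \matrix_(x, y) (y == n - k + x :> nat)%N%:R.
Proof.
have -> : 0 = \matrix_(x < k, y < n - k) (0 : R).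
  by apply/matrixP=> x y; rewrite !mxE.
rewrite (row_mxIE _ (fun _ _ => 0)); apply/matrixP=> x y; rewrite !mxE.
by case: ifP => // lt_y; rewrite ltn_eqF // ltn_addr.
Qed.

(** Reversing the order of both rows and columns moves the identity block from the right end to the
    left end. *)
Lemma row_mxI0_pid n k (le_kn : (k <= n)%N) :
  exists P Q, [/\ P \in unitmx, Q \in unitmx &
    (pid_mx k : 'M[R]_(k, n)) = P *m row_mxI le_kn 0 *m Q].
Proof.
exists (perm_mx (perm rev_ord_inj)), (perm_mx (perm rev_ord_inj)^-1).
split; try exact: unitmx_perm.
rewrite -row_permE -col_permE row_mxI0E; apply/matrixP=> x y; rewrite !mxE.
rewrite !permE /= ltn_ord andbT; congr (_%:R); congr (nat_of_bool _).
by have := ltn_ord x; have := ltn_ord y; lia.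
Qed.

(** The matrix [G] is diag(1, P): a change of basis of the row space extends to the ambient
    module. *)
Lemma row_mxI0_mull n k (le_kn : (k <= n)%N) (P : 'M[R]_k) :
  P \in unitmx ->
  exists2 G, G \in unitmx & P *m row_mxI le_kn 0 = row_mxI le_kn 0 *m G.
Proof.
move=> Pu; rewrite /row_mxI; move: (subnK le_kn); move: (n - k)%N => l e.
clear le_kn; case: n / e; exists (block_mx 1%:M 0 0 P).
  by rewrite block_diag_mx_unit unitmx1.
rewrite !castmx_id mul_row_block mul_mx_row.
by rewrite !mulmx0 !mul0mx mulmx1 mul1mx addr0 add0r.
Qed.

End Unimodular.

(** * Powers of p and Smith form over Z/p^s *)

Section PrimePower.

Variables (p s : nat).
Hypotheses (p_prime : prime p) (s_gt0 : (0 < s)%N).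

Local Notation R := 'Z_(p ^ s).

Lemma ppow_gt1 : (1 < p ^ s)%N.
Proof. by rewrite -(exp1n s) ltn_exp2r // prime_gt1. Qed.

Lemma ppow_eq0 e : (p%:R ^+ e == 0 :> R) = (s <= e)%N.
Proof.
rewrite -natrX -(Zp_nat_mod ppow_gt1) -val_eqE /= val_Zp_nat ?ppow_gt1 //.
rewrite modn_mod -/(dvdn _ _) pfactor_dvdn ?expn_gt0 ?prime_gt0 //.
by rewrite pfactorK.
Qed.

Lemma ppow_min e : p%:R ^+ minn e s = p%:R ^+ e :> R.
Proof.
case: leqP => // le_se; apply/eqP.
by rewrite (eqP (_ : _ ^+ e == 0)) ppow_eq0 // ltnW.
Qed.

Lemma unit_coprime c : coprime p c -> (c%:R : R) \is a GRing.unit.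
Proof. by move=> pc; rewrite unitZpE ?ppow_gt1 // coprimeXl. Qed.

(** The p-adic valuation truncated at [s], which loses nothing since p^s = 0. Zero is treated apart
    because [logn p 0] is 0. *)
Definition pval (z : int) : nat := if z == 0 then s else minn (logn p `|z|) s.

Lemma pval_unit (z : int) :
  exists2 u : R, u \is a GRing.unit & z%:~R = u * p%:R ^+ pval z.
Proof.
rewrite /pval; case: eqVneq => [->|nz_z].
  by exists 1; rewrite ?unitr1 // mul1r; apply/esym/eqP; rewrite ppow_eq0.
have [|c pc zE] := pfactor_coprime p_prime (_ : 0 < `|z|)%N;
  first by rewrite absz_gt0.
exists ((-1) ^+ (z < 0)%R * c%:R).
  by rewrite unitrMl ?unit_coprime // unitrX // unitrN1.
rewrite {1}[z]intEsign rmorphM rmorphXn rmorphN1 ppow_min -mulrA; congr (_ * _).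
rewrite /= {1}zE; transitivity ((c * p ^ logn p `|z|)%:R : R) => //.
by rewrite natrM natrX.
Qed.

Lemma pval_le z : (pval z <= s)%N.
Proof. by rewrite /pval; case: ifP => // _; rewrite geq_minr. Qed.

Lemma pval_dvd z t : (z %| t)%Z -> (pval z <= pval t)%N.
Proof.
rewrite {2}/pval; case: eqVneq => [_|nz_t z_t]; first by rewrite pval_le.
rewrite /pval; case: eqVneq => [z0|nz_z].
  by move: z_t nz_t; rewrite z0 dvd0z => ->.
rewrite leq_min geq_minr andbT (leq_trans (geq_minl _ _)) //.
by rewrite dvdn_leq_log // absz_gt0.
Qed.

(** Lift the entries to integers, take the integral Smith form and reduce: each invariant factor
    becomes a unit times a power of p, and divisibility orders the exponents. *)
Lemma smith_ppow a b (X : 'M[R]_(a, b)) :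
  exists (P : 'M[R]_a) (Q : 'M[R]_b) (r : nat) (i : r.-tuple nat),
  [/\ P \in unitmx, Q \in unitmx, (r <= minn a b)%N,
      sorted leq i /\ (forall j : 'I_r, (tnth i j < s)%N)
    & X = P *m diag_ppow R p a b i *m Q].
Proof.
pose f : {rmorphism int -> R} := intr.
pose Xz := map_mx (fun z : R => Posz (z : nat)) X.
have XE : X = map_mx f Xz.
  by apply/matrixP=> x y; rewrite !mxE -[RHS]/((X x y)%:R) natr_Zp.
have [L Lu [Q Qu [d d_sorted XzE]]] := int_Smith_normal_form Xz.
have fu c (M : 'M[int]_c) : M \in unitmx -> map_mx f M \in unitmx.
  by rewrite !unitmxE det_map_mx; apply: rmorph_unit.
have d_mono x y : (x <= y)%N -> (pval d`_x <= pval d`_y)%N.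
  move=> le_xy; apply: pval_dvd.
  have [lt_y|ge_y] := ltnP y (size d); last by rewrite (nth_default _ ge_y) dvdz0.
  apply: (sorted_leq_nth dvdz_trans dvdzz 0 d_sorted) => //.
  exact: leq_ltn_trans lt_y.
pose es := mkseq (fun x => pval d`_x) (minn a b).
(* The first index whose exponent reaches [s]: by monotonicity, all diagonal entries from there on
   vanish. *)
pose r := find (leq s) es.
have le_r : (r <= minn a b)%N.
  by apply: leq_trans (find_size _ _) _; rewrite size_mkseq.
have size_i : size (take r es) == r by rewrite size_takel // size_mkseq.
have nth_i x : (x < r)%N -> nth 0%N (take r es) x = pval d`_x.
  by move=> ltx; rewrite nth_take // nth_mkseq // (leq_trans ltx).
have lt_i x : (x < r)%N -> (pval d`_x < s)%N.
  move=> ltx; have := before_find 0%N ltx; rewrite nth_mkseq ?(leq_trans ltx) //.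
  by rewrite ltnNge => ->.
have ge_i x : (r <= x)%N -> (x < minn a b)%N -> pval d`_x = s.
  move=> gex ltx; apply/eqP; rewrite eqn_leq pval_le /=.
  have lt_r : (r < minn a b)%N by apply: leq_ltn_trans ltx.
  apply: leq_trans (d_mono _ _ gex).
  have /(nth_find 0%N) : has (leq s) es by rewrite has_find size_mkseq.
  by rewrite nth_mkseq.
(* The unit parts of the invariant factors are absorbed into the left factor. *)
have [u u_unit uE] := fin_all_exists2 (fun x : 'I_a => pval_unit d`_x).
exists (map_mx f L *m diag_mx (\row_x u x)), (map_mx f Q), r, (Tuple size_i).
split=> //; last 2 first.
- split=> [|j]; last by rewrite (tnth_nth 0%N) nth_i // lt_i.
  by apply/take_sorted/(homo_sorted d_mono)/iota_sorted.
- rewrite XE XzE !map_mxM; congr (_ *m _); rewrite -mulmxA; congr (_ *m _).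
  apply/matrixP=> x y; rewrite mul_diag_mx !mxE /=.
  case: eqP => [xy|_] /=; last by rewrite mulr0.
  rewrite mulr1n uE; congr (_ * _); case: ltnP => [ltx|gex]; first by rewrite nth_i.
  by rewrite ge_i //; [apply/eqP; rewrite ppow_eq0 | rewrite leq_min {2}xy !ltn_ord].
- rewrite unitmx_mul fu //= unitmxE det_diag; apply: unitr_prod => x _.
  by rewrite mxE.
- exact: fu.
Qed.

(** * Completion and stable range for unimodular matrices *)

Lemma unimodular_smith k n (le_kn : (k <= n)%N) (M : 'M[R]_(k, n)) :
  unimodular M ->
  exists P Q, [/\ P \in unitmx, Q \in unitmx & M = P *m pid_mx k *m Q].
Proof.
have [P [Q [r [i [Pu Qu le_r _ ME]]]]] := smith_ppow M.
move=> /(unimodular_mul (P := invmx P) (Q := invmx Q)).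
rewrite !unitmx_inv => /(_ Pu Qu); rewrite ME mulmxA mulmxK // mulKmx //.
move=> [N DN1]; exists P, Q; split=> //; congr (_ *m _ *m _).
(* Multiplication by [p ^ (s - 1)] kills every row other than a standard
   basis vector, but a row of a unimodular matrix is only killed by [0]. *)
have row_i (x : 'I_k) : (x < r)%N && (nth 0%N i x == 0%N).
  apply/negP=> x_bad.
  have: p%:R ^+ s.-1 *: row x (diag_ppow R p k n i) *m N = 0.
    suff -> : p%:R ^+ s.-1 *: row x (diag_ppow R p k n i) = 0 by rewrite mul0mx.
    apply/rowP=> y; rewrite !mxE; case: ifP => [/andP[_ ltx]|_];
      last by rewrite mulr0.
    rewrite -exprD; apply/eqP; rewrite ppow_eq0; move: x_bad; rewrite ltx /=; lia.
  rewrite -scalemxAl -row_mul DN1 => /rowP/(_ x)/eqP.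
  by rewrite !mxE eqxx mulr1 ppow_eq0; lia.
apply/matrixP=> x y; rewrite !mxE ltn_ord andbT.
have /andP[-> /eqP->] := row_i x.
by rewrite andbT; case: eqP.
Qed.

(** The left factor of the Smith form is moved to the right by [row_mxI0_mull], so the given basis
    itself, not just its span, is completed. *)
Lemma unimodular_completion k n (le_kn : (k <= n)%N) (M : 'M[R]_(k, n)) :
  unimodular M -> exists2 V, V \in unitmx & M = row_mxI le_kn 0 *m V.
Proof.
move=> /(unimodular_smith le_kn)[P [Q [Pu Qu ->]]].
have [P' [Q' [P'u Q'u ->]]] := row_mxI0_pid R le_kn.
have [|G Gu GE] := row_mxI0_mull le_kn (_ : P *m P' \in unitmx).
  by rewrite unitmx_mul Pu.
exists (G *m Q' *m Q); last by rewrite !mulmxA -GE.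
by rewrite !unitmx_mul Gu Q'u.
Qed.

(* [Z/p^s] has stable range one: modulo [p], [Y] is equivalent to a partial
   identity, and the rows of [X] can fill in the missing diagonal entries. *)
Lemma unimodular_stable_range m l k (le_mk : (m <= k)%N)
    (X : 'M[R]_(m, l)) (Y : 'M[R]_(m, k)) :
  unimodular (row_mx X Y) -> exists Z, unimodular (Y + X *m Z).
Proof.
have [P [Q [r [i [Pu Qu _ _ YE]]]]] := smith_ppow Y.
case=> N; rewrite -[N]vsubmxK mul_row_col.
set N1 := usubmx N; set N2 := dsubmx N => XY1.
(* [Pi] projects onto the positions where the diagonal entry is 1; the other entries are divisible
   by p, with quotients in [D1]. *)
pose unit_at (y : nat) := (y < r)%N && (nth 0%N i y == 0%N).
pose Pi : 'M[R]_k := diag_mx (\row_y (unit_at y)%:R).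
pose D1 : 'M[R]_k := diag_mx
  (\row_y if (y < r)%N && (nth 0%N i y != 0%N) then p%:R ^+ (nth 0%N i y).-1 else 0).
have PiPi : Pi *m Pi = Pi.
  rewrite mulmx_diag; congr diag_mx; apply/rowP=> y; rewrite !mxE.
  by rewrite -natrM mulnb andbb.
pose J : 'M[R]_(m, k) := pid_mx m.
have JJ : J *m (pid_mx m : 'M_(k, m)) = 1%:M by rewrite pid_mx_id // pid_mx_1.
have DE : diag_ppow R p m k i = J *m (Pi + p%:R *: D1).
  rewrite mulmxDr -scalemxAr !mul_mx_diag; apply/matrixP=> x y.
  rewrite !mxE ltn_ord andbT /unit_at.
  case: eqP => [<-|_] /=; last by rewrite !mul0r mulr0 addr0.
  rewrite !mul1r; case: ltnP => _ /=; last by rewrite mulr0 addr0.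
  by case: (nth _ _ _) => [|e] /=; rewrite ?mulr0 ?addr0 ?expr0 // add0r exprS.
(* Since [X *m N1 = 1 - Y *m N2], this choice adds [P *m J *m (1 - Pi) *m Q] to [Y], filling the
   missing entries. Modulo p, the remaining error turns [J] into [J *m (1 - F)], and [F] squares to
   zero because [(1 - Pi) *m Pi = 0]. *)
pose Z := N1 *m P *m J *m (1%:M - Pi) *m Q; exists Z.
pose F := Pi *m (Q *m N2 *m P *m J) *m (1%:M - Pi).
have FF : F *m F = 0.
  rewrite /F -(mulmxA _ (1%:M - Pi)) (mulmxA (1%:M - Pi)).
  rewrite (mulmxA (1%:M - Pi)).
  by rewrite mulmxBl mul1mx PiPi subrr !mul0mx mulmx0.
have -> : Y + X *m Z =
    P *m (J *m (1%:M - F)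
          + p%:R *: (J *m D1 *m (1%:M - Q *m N2 *m P *m J *m (1%:M - Pi)))) *m Q.
  set K := Q *m N2 *m P *m J *m (1%:M - Pi).
  have FK : F = Pi *m K by rewrite /F /K !mulmxA.
  have XZ : X *m Z = P *m J *m (1%:M - Pi - (Pi + p%:R *: D1) *m K) *m Q.
    have XN1 : X *m N1 = 1%:M - Y *m N2 by rewrite -XY1 addrK.
    rewrite /Z !mulmxA XN1 {1}YE DE /K.
    move: (1%:M - Pi) => W.
    by rewrite mulmxBr !mulmxBl !mul1mx !mulmxA.
  rewrite XZ {1}YE DE FK (mulmxA P J) -mulmxDl -mulmxDr.
  rewrite -(mulmxA J D1) scalemxAr -mulmxDr (mulmxA P J); congr (_ *m _ *m _).
  rewrite mulmxDl mulmxBr mulmx1 scalerBr -scalemxAl.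
  rewrite addrC addrA [X in X + _ = _]addrAC subrK opprD !addrA.
  by rewrite [LHS]addrAC.
apply: unimodular_mul => //.
apply: (@unimodular_add_nilpotent _ _ _ _ _ _ s).
  by apply/eqP; rewrite ppow_eq0.
(* [1 + F] is the inverse of [1 - F]. *)
exists ((1%:M + F) *m pid_mx m); rewrite mulmxA -(mulmxA J).
by rewrite mulmxDr mulmx1 mulmxBl mul1mx FF subr0 subrK mulmx1 JJ.
Qed.

End PrimePower.

(** * Construction of the common coordinates *)

Theorem theorem3p1 (p s n k m : nat)
  (p_prime : prime p) (s_ge1 : (1 <= s)%N)
  (lt_kn : (k < n)%N) (le_mk : (m <= k)%N) (m_ge1 : (1 <= m)%N)
  (A B : {set 'rV['Z_(p ^ s)]_n})
  (A_sub : is_subspace k A) (B_sub : is_subspace m B)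
  (B_not_in_A : ~~ (B \subset A)) :
  exists (U : 'M['Z_(p ^ s)]_n) (r : nat) (i : r.-tuple nat),
    [/\ U \in unitmx,
        (1 <= r <= minn m (n - k))%N,
        sorted leq i /\ (forall j : 'I_r, (tnth i j <= maxn (s - 1) 1)%N),
        A = row_space (row_mxI (ltnW lt_kn) 0 *m U)
      & B = row_space
              (row_mxI (leq_trans le_mk (ltnW lt_kn))
                 (diag_ppow 'Z_(p ^ s) p m (n - m) i) *m U)].
Proof.
have [_ [MA [MA_uni [_ AE]]]] := A_sub; have [_ [MB [MB_uni [_ BE]]]] := B_sub.
have [V Vu MAE] := unimodular_completion p_prime s_ge1 (ltnW lt_kn) MA_uni.
pose e := subnK (ltnW lt_kn).
pose XY := castmx (erefl m, esym e) (MB *m invmx V).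
pose X := lsubmx XY; pose Y := rsubmx XY.
have MBE : MB = castmx (erefl m, e) (row_mx X Y) *m V.
  by rewrite hsubmxK castmxKV mulmxKV.
have [P [Q [r [i [Pu Qu le_r [i_sorted i_lt] XE]]]]] := smith_ppow p_prime s_ge1 X.
set S := diag_ppow _ _ _ _ _ in XE.
have XYE : row_mx (S *m Q) (invmx P *m Y) = invmx P *m XY.
  by rewrite -[XY]hsubmxK mul_mx_row -/X XE -mulmxA mulKmx.
have XY_uni : unimodular (row_mx (S *m Q) (invmx P *m Y)).
  rewrite XYE -[_ *m XY]mulmx1; apply: unimodular_mul (unitmx1 _ _) _.
    by rewrite unitmx_inv.
  apply: castmx_unimodular; rewrite -[MB]mul1mx.
  by apply: unimodular_mul; rewrite ?unitmx1 ?unitmx_inv.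
have [Z /(unimodular_completion p_prime s_ge1 le_mk)[W Wu WE]] :=
  unimodular_stable_range p_prime s_ge1 le_mk XY_uni.
(* The zero block makes [U0] preserve (0, I_k) up to the basis change [W]. The block [- (Q *m Z)]
   undoes the column combinations that made the right part of [B] unimodular. *)
pose U0 := block_mx Q (- (Q *m Z)) 0 W.
have AU0 : row_mxI (ltnW lt_kn) 0 *m castmx (e, e) U0
    = W *m row_mxI (ltnW lt_kn) 0.
  rewrite castmx_mul_sqr -castmx_mulr; congr castmx.
  rewrite mul_row_block mul_mx_row.
  by rewrite !mul0mx !mulmx0 mul1mx mulmx1 !add0r.
(* [D] has k - m more columns than [S]; they vanish because r is at most n - k. *)
have DE : row_mxI (leq_trans le_mk (ltnW lt_kn)) (diag_ppow _ p m (n - m) i)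
    = castmx (erefl m, e) (row_mx S (row_mxI le_mk 0)).
  rewrite (row_mxIE _ (fun x y => if (x == y) && (x < r)%N
                                  then p%:R ^+ nth 0%N i x else 0)).
  rewrite row_mxI0E; apply/matrixP=> x y; rewrite castmxE !mxE cast_ord_id.
  case: splitP => z /= zE; rewrite !mxE.
    by rewrite zE (leq_trans (ltn_ord z)) // leq_sub2l.
  have -> : (x == y :> nat) && (x < r)%N = false by rewrite zE; lia.
  have := ltn_ord x; have := ltn_ord z; move: zE.
  case: ifP => [lt_y|_] zE ltz ltx; last by congr (_%:R); lia.
  by rewrite (_ : _ == _ = false) //; lia.
have BU0 : row_mxI (leq_trans le_mk (ltnW lt_kn)) (diag_ppow _ p m (n - m) i)
    *m castmx (e, e) U0 = invmx P *m (MB *m invmx V).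
  rewrite DE castmx_mul_sqr mul_row_block mulmx0 addr0 -WE.
  rewrite mulmxN mulmxA addrCA addNr addr0 XYE castmx_mulr.
  by rewrite castmxKV.
exists (castmx (e, e) U0 *m V), r, i; split=> //.
- rewrite unitmx_mul Vu andbT castmx_unit unitmxE det_ublock unitrM.
  by rewrite -!unitmxE Qu.
(* If r = 0 then X = 0, so the basis of [B] is [Y *m MA] and [B] lies in [A]. *)
- rewrite le_r andbT lt0n; apply: contra B_not_in_A => /eqP r0.
  have X0 : X = 0.
    rewrite XE (_ : S = 0) ?mulmx0 ?mul0mx //.
    by apply/matrixP=> x y; rewrite !mxE [(x < r)%N]ltnNge {1}r0 andbF.
  have MBY : MB = Y *m MA.
    by rewrite MBE X0 MAE mulmxA -castmx_mulr mul_mx_row mulmx0 mulmx1.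
  rewrite AE BE MBY; apply/subsetP=> _ /imsetP[x _ ->].
  by rewrite mulmxA; apply/imsetP; exists (x *m Y).
- by split=> // j; have := i_lt j; lia.
- by rewrite mulmxA AU0 -mulmxA row_space_mull // -MAE.
- by rewrite mulmxA BU0 -mulmxA mulmxKV // row_space_mull ?unitmx_inv.
Qed.
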